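(* Let $X$ be a real or complex Banach space, let $U:\Delta_{+}\to\mathcal{B}(X)$ be an evolution operator and let $P:\mathbb{R}_{+}\to\mathcal{B}(X)$ be a projection valued function compatible with $U$ (with $Q(t)=Id-P(t)$). Suppose that $U$ has $P$-exponential growth, with constants $M\geq1$, $\varepsilon\geq0$, $\omega>0$, and that there exist $K\geq 1$, $\gamma>\varepsilon$ and $\delta\in[0,\gamma)$ such that for each $H\in\mathcal{H}_{\gamma}(P)$ there is a Lyapunov function $L:\mathbb{R}_{+}\times X\to\mathbb{R}$ corresponding to $U$, $P(\cdot)$ and $H(\cdot)$ which satisfies, for all $(t,x)\in\mathbb{R}_{+}\times X$: $(L_1)$ $L(t,P(t)x)\geq 0$ and $L(t,Q(t)x)\leq 0$; $(L_2)$ $e^{-2\gamma t}L(t,P(t)x)-e^{2\gamma t}L(t,Q(t)x)\leq Ke^{2\delta t}\|x\|^{2}$. Then $U$ has a strong exponential dichotomy.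
   Context: Let $X$ be a real or complex Banach space, $\mathcal{B}(X)$ the Banach algebra of bounded linear operators on $X$, and $\Delta_{+}=\{(t,s)\in\mathbb{R}_{+}\times\mathbb{R}_{+}: t\geq s\}$, where $\mathbb{R}_+=[0,\infty)$. Evolution operator: a map $U:\Delta_{+}\to\mathcal{B}(X)$ with $U(t,t)=Id$ for all $t\ge 0$; $U(t,s)U(s,t_0)=U(t,t_0)$ for all $t\geq s\geq t_0\ge 0$; and $(t,s)\mapsto U(t,s)x$ continuous on $\Delta_{+}$ for every $x\in X$. Projection valued function: a strongly continuous map $P:\mathbb{R}_{+}\to\mathcal{B}(X)$ with $P(t)^2=P(t)$ for all $t$; write $Q(t)=Id-P(t)$, so $\operatorname{Ker}P(t)=\operatorname{Range}Q(t)$. Compatibility: $P(\cdot)$ is compatible with $U$ if $P(t)U(t,s)=U(t,s)P(s)$ for all $(t,s)\in\Delta_{+}$ and the restriction $U(t,s)|_{\operatorname{Ker}P(s)}:\operatorname{Ker}P(s)\to\operatorname{Ker}P(t)$ is an isomorphism for each $(t,s)\in\Delta_{+}$; its inverse is denoted $V(s,t):\operatorname{Ker}P(t)\to\operatorname{Ker}P(s)$. Strong exponential dichotomy: $U$ has a strong exponential dichotomy if there are a projection valued function $P$ compatible with $U$ and constants $N\geq1$, $\alpha\geq0$, $\beta>0$ with $\|U(t,s)P(s)\|\leq Ne^{\alpha s}e^{-\beta(t-s)}$ and $\|V(s,t)Q(t)\|\leq Ne^{\alpha s}e^{-\beta(t-s)}$ for all $(t,s)\in\Delta_{+}$. $P$-exponential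 growth: for $P$ compatible with $U$, $U$ has $P$-exponential growth (with constants $M,\varepsilon,\omega$) if there exist $M\geq1$, $\varepsilon\geq0$, $\omega>0$ with $\|U(t,s)P(s)\|\leq Me^{\varepsilon s}e^{\omega(t-s)}$ and $\|V(s,t)Q(t)\|\leq Me^{\varepsilon s}e^{\omega(t-s)}$ for all $(t,s)\in\Delta_{+}$. For $\gamma>0$, $\mathcal{H}_{\gamma}(P)$ is the set of all strongly continuous maps $H:\mathbb{R}_{+}\to\mathcal{B}(X)$ with $\|H(t)x\|\leq e^{\gamma t}\|P(t)x\|+e^{-\gamma t}\|Q(t)x\|$ for all $(t,x)\in\mathbb{R}_{+}\times X$. Lyapunov function: given $U$, a compatible $P(\cdot)$ and $H\in\mathcal{H}_{\gamma}(P)$, a continuous function $L:\mathbb{R}_{+}\times X\to\mathbb{R}$ is a Lyapunov function corresponding to $U$, $P(\cdot)$ and $H(\cdot)$ if $L(t,U(t,s)x)+\int_{s}^{t}\|H(\tau)U(\tau,s)x\|^{2}d\tau\leq L(s,x)$ for all $(t,s)\in\Delta_{+}$ and $x\in X$. *)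

(* Defs.v *)
(* Stdlib reals with Coquelicot. *)
From Stdlib Require Import Reals ClassicalEpsilon.
From Coquelicot Require Import Coquelicot.

Set Implicit Arguments.
Unset Strict Implicit.
Unset Printing Implicit Defensive.

Local Open Scope R_scope.

(* A function on R_+, Delta_+ or R_+ x X is represented by a total one, and
   every hypothesis on it is restricted to the actual domain.  Continuity is
   continuity relative to the domain. *)
Definition continuous_within {S T : UniformSpace} (D : S -> Prop) (f : S -> T) : Prop :=
  forall p : S, D p -> filterlim f (within D (locally p)) (locally (f p)).

Definition Rnonneg (t : R) : Prop := 0 <= t.

Definition Delta (t s : R) : Prop := 0 <= s <= t.

Section Dichotomy.

Context {F : AbsRing} {X : CompleteNormedModule F}.

(* B(X); the predicate [is_linear] includes boundedness. *)
Record bounded_op := BoundedOp {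
  op_fun :> X -> X;
  op_is_linear : is_linear op_fun }.

(* The operator norm, sup {|T x| : |x| <= 1}.  It lies in the extended reals, so
   that a finite bound on it asserts that [T] is bounded. *)
Definition op_norm (T : X -> X) : Rbar :=
  Lub_Rbar (fun r => exists x : X, norm x <= 1 /\ r = norm (T x)).

Definition evolution_operator (U : R -> R -> bounded_op) : Prop :=
  (forall t x, 0 <= t -> U t t x = x) /\
  (forall t s t0 x, Delta t s -> Delta s t0 -> U t s (U s t0 x) = U t t0 x) /\
  (forall x, continuous_within (fun p : R * R => Delta (fst p) (snd p))
                               (fun p => U (fst p) (snd p) x)).

Definition strongly_continuous (A : R -> bounded_op) : Prop :=
  forall x, continuous_within Rnonneg (fun t => A t x).

Definition projection_valued (P : R -> bounded_op) : Prop :=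
  strongly_continuous P /\ (forall t x, 0 <= t -> P t (P t x) = P t x).

Definition Qproj (P : R -> bounded_op) (t : R) (x : X) : X := minus x (P t x).

Definition Ker (T : X -> X) (x : X) : Prop := T x = zero.

(* [f] restricts to an isomorphism of normed spaces from [A] onto [B]; linearity
   of [g] on [B] is automatic when [f] is linear and [A], [B] are subspaces. *)
Definition restricts_to_iso (A B : X -> Prop) (f : X -> X) : Prop :=
  (forall x, A x -> B (f x)) /\
  (exists g : X -> X,
     (forall y, B y -> A (g y)) /\
     (forall x, A x -> g (f x) = x) /\
     (forall y, B y -> f (g y) = y) /\
     (exists C : R, forall y, B y -> norm (g y) <= C * norm y)).

Definition compatible (U : R -> R -> bounded_op) (P : R -> bounded_op) : Prop :=
  forall t s, Delta t s ->
    (forall x, P t (U t s x) = U t s (P s x)) /\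
    restricts_to_iso (Ker (P s)) (Ker (P t)) (U t s).

(* V(s,t) : Ker P(t) -> Ker P(s), the inverse of the restriction of U(t,s).  For
   compatible [U], [P], the point chosen exists and is unique when [y] is in
   Ker P(t); the values elsewhere are irrelevant. *)
Definition Vinv (U : R -> R -> bounded_op) (P : R -> bounded_op) (s t : R) (y : X) : X :=
  epsilon (inhabits (zero : X)) (fun x => Ker (P s) x /\ U t s x = y).

Definition strong_exponential_dichotomy (U : R -> R -> bounded_op) : Prop :=
  exists P : R -> bounded_op,
    projection_valued P /\ compatible U P /\
    exists N alpha beta : R, 1 <= N /\ 0 <= alpha /\ 0 < beta /\
      forall t s, Delta t s ->
        Rbar_le (op_norm (fun x => U t s (P s x)))
                (N * exp (alpha * s) * exp (- beta * (t - s))) /\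
        Rbar_le (op_norm (fun x => Vinv U P s t (Qproj P t x)))
                (N * exp (alpha * s) * exp (- beta * (t - s))).

Definition P_exponential_growth (U : R -> R -> bounded_op) (P : R -> bounded_op)
    (M eps omega : R) : Prop :=
  1 <= M /\ 0 <= eps /\ 0 < omega /\
  forall t s, Delta t s ->
    Rbar_le (op_norm (fun x => U t s (P s x)))
            (M * exp (eps * s) * exp (omega * (t - s))) /\
    Rbar_le (op_norm (fun x => Vinv U P s t (Qproj P t x)))
            (M * exp (eps * s) * exp (omega * (t - s))).

Definition in_H (gamma : R) (P H : R -> bounded_op) : Prop :=
  strongly_continuous H /\
  (forall t x, 0 <= t ->
     norm (H t x) <= exp (gamma * t) * norm (P t x)
                     + exp (- gamma * t) * norm (Qproj P t x)).

(* For H in H_gamma(P) the integrand is continuous on [s, t] (H is locally bounded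
   because P is), so the total function [RInt] is the actual integral. *)
Definition lyapunov_function (U : R -> R -> bounded_op) (H : R -> bounded_op)
    (L : R -> X -> R) : Prop :=
  continuous_within (fun p : R * X => 0 <= fst p) (fun p => L (fst p) (snd p)) /\
  (forall t s x, Delta t s ->
     L t (U t s x) + RInt (fun tau => norm (H tau (U tau s x)) ^ 2) s t <= L s x).

End Dichotomy.

Arguments bounded_op {F} X.

(* Main.v *)
From Stdlib Require Import Reals Lra ClassicalEpsilon.
From Coquelicot Require Import Coquelicot.
Require Import Defs.

Local Open Scope R_scope.

(** The theorem is an observability argument: a Lyapunov function that controls
    the energy of an orbit, combined with the growth bound, controls the orbit
    itself, in the manner of the Datko-Pazy theorem.

    Two weights suffice.  For the stable part, take [H t = e^(gamma t) P t].  Along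
    [u tau = U tau s (P s x)] the function [L] stays nonnegative, so the energy
    [int_s^t e^(2 gamma tau) |u tau|^2] is at most [L s (P s x)], which is at
    most [K e^(2 (gamma + delta) s) |x|^2]: the two terms of the second condition on
    [L] are nonnegative, so its right-hand side bounds each of them.  For the unstable
    part, take [H t = e^(-gamma t) Q t] and the orbit that ends at [Q t y], that is
    [u tau = U tau s (V s t (Q t y))].  Now [L] is nonpositive at time [s], so the
    energy [int_s^t e^(-2 gamma tau) |u tau|^2] is at most [- L t (Q t y)], hence at
    most [K e^(-2 (gamma - delta) t) |y|^2].

    To return from energies to points, integrate over one unit of time only
    ([orbit_energy_ge]): over [t - 1, t] the growth bound gives
    [|u t| <= M e^(eps t + omega) |u tau|] in the stable case, and over [s, s + 1] it
    gives [|u s| <= M e^(eps s + omega) |u tau|] in the unstable case.  Collecting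
    exponents yields the rates [gamma - eps] and [gamma - delta] with nonuniformity
    [eps + delta] ([stable_decay], [unstable_decay]).  When [t - s < 1] the growth
    bound is itself a decay bound.  *)

(** * The exponential function *)

Lemma exp_le (a b : R) : a <= b -> exp a <= exp b.
Proof. intros [h | ->]; [apply Rlt_le; now apply exp_increasing | apply Rle_refl]. Qed.

Lemma continuous_exp_linear (c t : R) : continuous (fun t => exp (c * t)) t.
Proof.
apply (continuous_exp_comp (fun t => c * t)).
apply (continuous_scal_r c (fun t : R => t)), continuous_id.
Qed.

(** * Real scalars in the ground field *)

(** What the argument needs from the ground field, so that the real and the complex
    case are treated at once: commutativity and an isometric copy of the reals. *)
Record real_scalars {F : AbsRing} (iota : R -> F) : Prop := {
  scalars_comm : forall a b : F, mult a b = mult b a;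
  iota_one : iota 1 = one;
  iota_mult : forall a b, iota (a * b) = mult (iota a) (iota b);
  iota_minus : forall a b, iota (a - b) = minus (iota a) (iota b);
  iota_abs : forall a, abs (iota a) = Rabs a }.

Lemma real_scalars_R : real_scalars (F := R_AbsRing) (fun r => r).
Proof. split; try reflexivity. exact Rmult_comm. Qed.

Lemma real_scalars_C : real_scalars (F := C_AbsRing) RtoC.
Proof.
split; [exact Cmult_comm | reflexivity | exact RtoC_mult | exact RtoC_minus | exact Cmod_R].
Qed.

Lemma real_scalars_continuous {F : AbsRing} (iota : R -> F) (hi : real_scalars iota) (r : R) :
  filterlim iota (locally r) (locally (iota r)).
Proof.
intros A [e He]. exists e. intros y Hy. apply He.
unfold ball; simpl; unfold AbsRing_ball.
rewrite <- (iota_minus _ hi), (iota_abs _ hi). exact Hy.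
Qed.

Section Dichotomy.

Context {F : AbsRing} {X : CompleteNormedModule F}.
Variables (iota : R -> F) (hi : real_scalars iota).

Lemma norm_scal_real (r : R) (x : X) :
  0 < r -> norm (scal (iota r) x) = r * norm x.
Proof.
intros hr.
assert (le : forall r (y : X), 0 < r -> norm (scal (iota r) y) <= r * norm y).
{ intros q y hq. rewrite <- (Rabs_pos_eq q) at 2 by lra.
  rewrite <- (iota_abs _ hi). apply (@norm_scal F X). }
apply Rle_antisym. { now apply le. }
assert (h := le (/ r) (scal (iota r) x) (Rinv_0_lt_compat _ hr)).
rewrite scal_assoc, <- (iota_mult _ hi), Rinv_l, (iota_one _ hi), scal_one in h by lra.
apply (Rmult_le_compat_l r) in h; [|lra].
rewrite <- Rmult_assoc, Rinv_r, Rmult_1_l in h by lra. exact h.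
Qed.

(** A bound on the unit ball passes to all vectors by rescaling; homogeneity over the
    reals is enough for that. *)
Lemma norm_le_of_op_norm (T : X -> X) (B : R) :
  (forall r x, T (scal (iota r) x) = scal (iota r) (T x)) ->
  Rbar_le (op_norm T) B -> forall x, norm (T x) <= B * norm x.
Proof.
intros hT hB x.
assert (unit : forall y, norm y <= 1 -> norm (T y) <= B).
{ intros y hy. destruct (Lub_Rbar_correct (fun r => exists x, norm x <= 1 /\ r = norm (T x)))
    as [ub _].
  exact (Rbar_le_trans (norm (T y)) _ B (ub _ (ex_intro _ y (conj hy eq_refl))) hB). }
destruct (Req_dec (norm x) 0) as [h0 | h0].
- assert (hTx : T x = scal (iota 0) (T x)).
  { rewrite <- hT. f_equal. rewrite (@norm_eq_zero F X x h0). symmetry. exact (@scal_zero_r F X _). }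
  assert (h : norm (scal (iota 0) (T x)) <= abs (iota 0) * norm (T x))
    by apply (@norm_scal F X).
  rewrite <- hTx, (iota_abs _ hi), Rabs_R0 in h. rewrite h0. lra.
- assert (hp : 0 < norm x) by (generalize (@norm_ge_0 F X x); lra).
  assert (hx : x = scal (iota (norm x)) (scal (iota (/ norm x)) x)).
  { rewrite scal_assoc, <- (iota_mult _ hi), Rinv_r, (iota_one _ hi), scal_one by lra.
    reflexivity. }
  rewrite hx at 1. rewrite hT, norm_scal_real, Rmult_comm by lra.
  apply Rmult_le_compat_r; [lra|]. apply unit.
  rewrite norm_scal_real by (now apply Rinv_0_lt_compat). rewrite Rinv_l; lra.
Qed.

Lemma op_norm_le (T : X -> X) (B : R) :
  0 <= B -> (forall x, norm (T x) <= B * norm x) -> Rbar_le (op_norm T) B.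
Proof.
intros hB h.
destruct (Lub_Rbar_correct (fun r => exists x, norm x <= 1 /\ r = norm (T x))) as [_ lub].
apply lub. intros r [x [hx ->]]. simpl.
generalize (h x); nra.
Qed.

(** * Weighted projections *)

Lemma is_linear_Qproj (P : R -> bounded_op X) (t : R) : is_linear (Qproj P t).
Proof.
apply (is_linear_comp (fun x : X => (x, opp (P t x)))
         (fun p : X * X => plus (fst p) (snd p))); [|exact (@is_linear_plus F X)].
apply is_linear_prod; [exact (@is_linear_id F X)|].
apply is_linear_comp; [apply op_is_linear | exact (@is_linear_opp F X)].
Qed.

Definition complement (P : R -> bounded_op X) (t : R) : bounded_op X :=
  BoundedOp (is_linear_Qproj P t).

Lemma is_linear_weighted (c : R) (T : bounded_op X) :
  is_linear (fun x => scal (iota c) (T x)).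
Proof.
apply (is_linear_comp T (fun x : X => scal (iota c) x)); [apply op_is_linear|].
exact (@is_linear_scal_r F X _ (scalars_comm _ hi)).
Qed.

Definition weighted (c : R) (A : R -> bounded_op X) (t : R) : bounded_op X :=
  BoundedOp (is_linear_weighted (exp (c * t)) (A t)).

Lemma strongly_continuous_complement (P : R -> bounded_op X) :
  strongly_continuous P -> strongly_continuous (complement P).
Proof.
intros hP x t ht. unfold complement; simpl; unfold Qproj, minus.
apply filterlim_comp_2 with (3 := @filterlim_plus F X x (opp (P t x))).
- exact (filterlim_const x).
- apply filterlim_comp with (1 := hP x t ht). exact (@filterlim_opp F X _).
Qed.

Lemma strongly_continuous_weighted (c : R) (A : R -> bounded_op X) :
  strongly_continuous A -> strongly_continuous (weighted c A).
Proof.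
intros hA x t ht. unfold weighted; simpl.
apply filterlim_comp_2 with (3 := @filterlim_scal F X (iota (exp (c * t))) (A t x)).
- apply (filterlim_filter_le_1 (F := locally t) _ (filter_le_within Rnonneg)).
  exact (filterlim_comp _ _ _ _ _ _ _ _ (continuous_exp_linear c t)
           (real_scalars_continuous iota hi _)).
- exact (hA x t ht).
Qed.

Lemma weighted_P_in_H (gamma : R) (P : R -> bounded_op X) :
  projection_valued P -> in_H gamma P (weighted gamma P).
Proof.
intros [hP _]. split; [now apply strongly_continuous_weighted|].
intros t x ht. simpl. rewrite norm_scal_real by apply exp_pos.
assert (h := Rmult_le_pos _ _ (Rlt_le _ _ (exp_pos (- gamma * t)))
               (@norm_ge_0 F X (Qproj P t x))).
lra.
Qed.

Lemma weighted_Q_in_H (gamma : R) (P : R -> bounded_op X) :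
  projection_valued P -> in_H gamma P (weighted (- gamma) (complement P)).
Proof.
intros [hP _].
split; [now apply strongly_continuous_weighted, strongly_continuous_complement|].
intros t x ht. simpl. rewrite norm_scal_real by apply exp_pos.
assert (h := Rmult_le_pos _ _ (Rlt_le _ _ (exp_pos (gamma * t)))
               (@norm_ge_0 F X (P t x))).
lra.
Qed.

(** * The inverse flow on the kernels *)

Lemma Ker_Qproj (P : R -> bounded_op X) t x :
  projection_valued P -> 0 <= t -> Ker (P t) (Qproj P t x).
Proof.
intros [_ hP] ht. unfold Ker, Qproj.
rewrite (linear_minus _ _ _ (op_is_linear (P t))), hP by exact ht.
exact (@minus_eq_zero X (P t x)).
Qed.

Lemma Qproj_of_Ker (P : R -> bounded_op X) t x : Ker (P t) x -> Qproj P t x = x.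
Proof. unfold Ker, Qproj. intros ->. exact (@minus_zero_r X x). Qed.

Variables (U : R -> R -> bounded_op X) (P : R -> bounded_op X).
Hypotheses (hU : evolution_operator U) (hP : projection_valued P) (hUP : compatible U P).

Lemma Vinv_spec t s y : Delta t s -> Ker (P t) y ->
  Ker (P s) (Vinv U P s t y) /\ U t s (Vinv U P s t y) = y.
Proof.
intros hd hy.
apply (epsilon_spec (inhabits (zero : X)) (fun x => Ker (P s) x /\ U t s x = y)).
destruct (hUP t s hd) as [_ [_ [g [hg [_ [hUg _]]]]]].
exists (g y). split; [now apply hg | now apply hUg].
Qed.

Lemma Vinv_unique t s x : Delta t s -> Ker (P s) x -> Vinv U P s t (U t s x) = x.
Proof.
intros hd hx.
destruct (hUP t s hd) as [_ [hmaps [g [_ [hgU _]]]]].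
destruct (Vinv_spec t s (U t s x) hd (hmaps x hx)) as [hk he].
rewrite <- (hgU _ hk), he. now apply hgU.
Qed.

Lemma Vinv_Qproj_scal t s c x : Delta t s ->
  Vinv U P s t (Qproj P t (scal c x)) = scal c (Vinv U P s t (Qproj P t x)).
Proof.
intros hd.
assert (ht : 0 <= t) by (unfold Delta in hd; lra).
destruct (Vinv_spec t s (Qproj P t x) hd (Ker_Qproj P t x hP ht)) as [hk he].
rewrite (linear_scal _ (is_linear_Qproj P t)).
rewrite <- he at 1. rewrite <- (linear_scal _ (op_is_linear (U t s))).
apply Vinv_unique; [exact hd|].
unfold Ker in *. rewrite (linear_scal _ (op_is_linear (P s))), hk. exact (@scal_zero_r F X c).
Qed.

Lemma Ker_orbit t s x : Delta t s -> Ker (P s) x -> Ker (P t) (U t s x).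
Proof. intros hd hx. destruct (hUP t s hd) as [_ [hmaps _]]. now apply hmaps. Qed.

(** * From the energy of an orbit to its values *)

(** Clamping the time at [s] extends the orbit continuously beyond its domain, which
    turns the one-sided continuity at [s] into continuity. *)
Lemma continuous_orbit s x z : 0 <= s ->
  continuous (fun tau => U (Rmax s tau) s x : X) z.
Proof.
intros hs. destruct hU as [_ [_ hc]].
assert (hd : Delta (Rmax s z) s) by (split; [exact hs | apply Rmax_l]).
intros A HA. destruct (hc x (Rmax s z, s) hd A HA) as [e He].
exists e. intros y Hy. apply (He (Rmax s y, s)).
- split; [|apply ball_center].
  revert Hy. unfold ball; simpl; unfold AbsRing_ball, abs, minus, plus, opp; simpl.
  intros Hy. apply Rle_lt_trans with (2 := Hy).
  unfold Rmax; destruct (Rle_dec s y), (Rle_dec s z); unfold Rabs;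
    repeat destruct Rcase_abs; lra.
- split; [exact hs | apply Rmax_l].
Qed.

(** If the observed orbit is at least [m] throughout one unit of time, its energy is
    at least [m ^ 2]. *)
Lemma orbit_energy_ge (H : R -> bounded_op X) (c s t a m : R) (z : X) :
  0 <= s -> s <= a -> a + 1 <= t -> 0 <= m ->
  (forall tau, s <= tau <= t -> norm (H tau (U tau s z)) = exp (c * tau) * norm (U tau s z)) ->
  (forall tau, a <= tau <= a + 1 -> m <= exp (c * tau) * norm (U tau s z)) ->
  m ^ 2 <= RInt (fun tau => norm (H tau (U tau s z)) ^ 2) s t.
Proof.
intros hs hsa hat hm hH hlow.
set (f := fun tau => norm (H tau (U tau s z)) ^ 2).
assert (hf : ex_RInt f s t).
{ apply ex_RInt_ext with (fun tau => (exp (c * tau) * norm (U (Rmax s tau) s z)) ^ 2).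
  - intros y hy. rewrite Rmin_left, Rmax_right in hy by lra.
    unfold f. rewrite Rmax_right, hH by lra. reflexivity.
  - apply (ex_RInt_continuous (V := R_CompleteNormedModule)). intros y _.
    assert (hc : continuous (fun tau => exp (c * tau) * norm (U (Rmax s tau) s z)) y).
    { apply (continuous_mult (K := R_AbsRing) (fun tau => exp (c * tau))).
      - apply continuous_exp_linear.
      - apply (continuous_comp (fun tau => U (Rmax s tau) s z : X) norm).
        + now apply continuous_orbit.
        + exact (@filterlim_norm F X _). }
    apply continuous_ext with
      (fun tau => mult (exp (c * tau) * norm (U (Rmax s tau) s z))
                       (exp (c * tau) * norm (U (Rmax s tau) s z))).
    + intros w. unfold mult; simpl. ring.
    + now apply (continuous_mult (K := R_AbsRing)). }
assert (h1 : ex_RInt f s (a + 1)) by (apply (ex_RInt_Chasles_1 f) with t; [lra | exact hf]).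
assert (h2 : ex_RInt f (a + 1) t) by (apply (ex_RInt_Chasles_2 f) with s; [lra | exact hf]).
assert (h3 : ex_RInt f s a) by (apply (ex_RInt_Chasles_1 f) with (a + 1); [lra | exact h1]).
assert (h4 : ex_RInt f a (a + 1)) by (apply (ex_RInt_Chasles_2 f) with s; [lra | exact h1]).
rewrite <- (RInt_Chasles f _ _ _ h1 h2), <- (RInt_Chasles f _ _ _ h3 h4).
unfold plus; simpl.
assert (hpos : forall tau, 0 <= f tau) by (intros tau; apply pow2_ge_0).
assert (g3 : 0 <= RInt f s a) by (apply RInt_ge_0; auto).
assert (g2 : 0 <= RInt f (a + 1) t) by (apply RInt_ge_0; auto).
assert (g4 : RInt (fun _ => m ^ 2) a (a + 1) <= RInt f a (a + 1)).
{ apply RInt_le; [lra | apply ex_RInt_const | exact h4 |].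
  intros tau htau. unfold f. rewrite hH by lra.
  apply pow_incr. split; [exact hm | apply hlow; lra]. }
rewrite RInt_const in g4. unfold scal in g4; simpl in g4; unfold mult in g4; simpl in g4.
lra.
Qed.

(** * Decay of the two parts *)

Variables (M eps omega : R).
Hypothesis hgrowth : P_exponential_growth U P M eps omega.

Lemma growth_stable t s x : Delta t s ->
  norm (U t s (P s x)) <= M * exp (eps * s) * exp (omega * (t - s)) * norm x.
Proof.
intros hd. destruct hgrowth as [_ [_ [_ h]]].
apply (norm_le_of_op_norm (fun x => U t s (P s x))); [|apply h; exact hd].
intros r y. now rewrite (linear_scal _ (op_is_linear (P s))), (linear_scal _ (op_is_linear (U t s))).
Qed.

Lemma growth_unstable t s x : Delta t s ->
  norm (Vinv U P s t (Qproj P t x)) <= M * exp (eps * s) * exp (omega * (t - s)) * norm x.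
Proof.
intros hd. destruct hgrowth as [_ [_ [_ h]]].
apply (norm_le_of_op_norm (fun x => Vinv U P s t (Qproj P t x))); [|apply h; exact hd].
intros r y. now apply Vinv_Qproj_scal.
Qed.

Variables (K gamma delta : R).
Hypotheses (hK : 1 <= K) (hgamma : eps < gamma) (hdelta : 0 <= delta < gamma).
Hypothesis hL : forall H : R -> bounded_op X, in_H gamma P H ->
  exists L : R -> X -> R,
    lyapunov_function U H L /\
    (forall t x, 0 <= t ->
       (0 <= L t (P t x) /\ L t (Qproj P t x) <= 0) /\
       exp (- 2 * gamma * t) * L t (P t x) - exp (2 * gamma * t) * L t (Qproj P t x)
         <= K * exp (2 * delta * t) * norm x ^ 2).

(** The common end of both estimates: extract square roots (with [sqrt K <= K]) and
    undo the weight and the growth factor. *)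
Lemma value_le_of_energy_le (v n w a b : R) :
  0 <= v -> 0 <= n ->
  (exp a * (v / (M * exp w))) ^ 2 <= exp b ^ 2 * (K * n ^ 2) ->
  v <= K * M * exp (w - a + b) * n.
Proof.
intros hv hn h. destruct hgrowth as [hM _].
assert (hw := exp_pos w). assert (ha := exp_pos a). assert (hb := exp_pos b).
assert (hMw : 0 < M * exp w) by (apply Rmult_lt_0_compat; lra).
assert (h' : exp a * (v / (M * exp w)) <= exp b * (K * n)).
{ apply Rsqr_incr_0_var.
  - rewrite !Rsqr_pow2. apply Rle_trans with (1 := h). rewrite !Rpow_mult_distr.
    apply Rmult_le_compat_l; [apply pow2_ge_0|].
    apply Rmult_le_compat_r; [apply pow2_ge_0 | nra].
  - apply Rmult_le_pos; [lra | nra]. }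
replace v with ((exp a * (v / (M * exp w))) * (exp (- a) * (M * exp w))).
- replace (K * M * exp (w - a + b) * n)
    with ((exp b * (K * n)) * (exp (- a) * (M * exp w))).
  + apply Rmult_le_compat_r; [|exact h'].
    apply Rmult_le_pos; [apply Rlt_le, exp_pos | lra].
  + unfold Rminus. rewrite !exp_plus. ring.
- rewrite exp_Ropp. field. lra.
Qed.

(** The unit interval ends at [t], so the growth bound costs [e^(eps t)]; this is why
    the rate is [gamma - eps] rather than [gamma]. *)
Lemma stable_decay t s x : 0 <= s -> s + 1 <= t ->
  norm (U t s (P s x)) <=
    K * M * exp (omega + gamma) * exp ((eps + delta) * s)
      * exp (- (gamma - eps) * (t - s)) * norm x.
Proof.
intros hs hst. destruct hgrowth as [hM [heps [homega _]]].
destruct hU as [_ [hcoc _]]. destruct hP as [_ hidem].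
destruct (hL _ (weighted_P_in_H gamma P hP)) as [L [[_ hdec] hbd]].
assert (hd : Delta t s) by (split; lra).
assert (commP : forall tau, s <= tau -> P tau (U tau s (P s x)) = U tau s (P s x)).
{ intros tau htau. destruct (hUP tau s) as [hc _]; [split; lra|].
  rewrite hc, hidem by lra. reflexivity. }
set (v := norm (U t s (P s x))).
assert (hv : 0 <= v) by apply norm_ge_0.
assert (hw := exp_pos (eps * t + omega)).
assert (hMw : 0 < M * exp (eps * t + omega)) by (apply Rmult_lt_0_compat; lra).
assert (energy : (exp (gamma * (t - 1)) * (v / (M * exp (eps * t + omega)))) ^ 2
   <= RInt (fun tau => norm (weighted gamma P tau (U tau s (P s x))) ^ 2) s t).
{ apply orbit_energy_ge with gamma (t - 1); try lra.
  - apply Rmult_le_pos; [apply Rlt_le, exp_pos|]. now apply Rdiv_le_0_compat.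
  - intros tau htau. simpl. rewrite commP, norm_scal_real by (lra || apply exp_pos).
    reflexivity.
  - intros tau htau.
    apply Rmult_le_compat; [apply Rlt_le, exp_pos | now apply Rdiv_le_0_compat | |].
    + apply exp_le. apply Rmult_le_compat_l; lra.
    + (* Growth from [tau] up to [t], with [tau >= t - 1]. *)
      apply Rle_div_l; [exact hMw|].
      unfold v. rewrite <- (hcoc t tau s) by (split; lra).
      rewrite <- (commP tau) at 1 by lra.
      eapply Rle_trans; [apply growth_stable; split; lra|].
      rewrite (Rmult_comm (norm _)). apply Rmult_le_compat_r; [apply norm_ge_0|].
      rewrite Rmult_assoc, <- exp_plus. apply Rmult_le_compat_l; [lra|].
      apply exp_le. nra. }
assert (h1 := hdec t s (P s x) hd).
destruct (hbd s x hs) as [[_ hQ] hsum].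
destruct (hbd t (U t s (P s x))) as [[hpos _] _]; [lra|].
rewrite commP in hpos by lra.
assert (h2 : L s (P s x) <= exp (gamma * s + delta * s) ^ 2 * (K * norm x ^ 2)).
{ assert (hg := exp_pos (2 * gamma * s)).
  assert (hLs : exp (- 2 * gamma * s) * L s (P s x) <= K * exp (2 * delta * s) * norm x ^ 2)
    by nra.
  apply (Rmult_le_compat_l (exp (2 * gamma * s))) in hLs; [|lra].
  rewrite <- Rmult_assoc, <- exp_plus in hLs.
  replace (2 * gamma * s + - 2 * gamma * s) with 0 in hLs by ring.
  rewrite exp_0, Rmult_1_l in hLs. apply Rle_trans with (1 := hLs). right.
  replace (exp (gamma * s + delta * s) ^ 2)
    with (exp (2 * gamma * s) * exp (2 * delta * s)); [ring|].
  simpl. rewrite Rmult_1_r, <- !exp_plus. f_equal. ring. }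
assert (h3 : v <= K * M * exp (eps * t + omega - gamma * (t - 1) + (gamma * s + delta * s))
                    * norm x).
{ apply value_le_of_energy_le; [exact hv | apply norm_ge_0 | lra]. }
apply Rle_trans with (1 := h3). right.
rewrite !(Rmult_assoc (K * M)), <- !Rmult_assoc, !(Rmult_assoc (K * M)), <- !exp_plus.
do 3 f_equal. ring.
Qed.

(** Here the unit interval starts at [s], so the growth bound only costs [e^(eps s)];
    the rate [gamma - delta] comes from the bound on [L] at time [t]. *)
Lemma unstable_decay t s y : 0 <= s -> s + 1 <= t ->
  norm (Vinv U P s t (Qproj P t y)) <=
    K * M * exp (omega + gamma) * exp ((eps + delta) * s)
      * exp (- (gamma - delta) * (t - s)) * norm y.
Proof.
intros hs hst. destruct hgrowth as [hM [heps [homega _]]].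
destruct (hL _ (weighted_Q_in_H gamma P hP)) as [L [[_ hdec] hbd]].
assert (hd : Delta t s) by (split; lra).
destruct (Vinv_spec t s (Qproj P t y) hd (Ker_Qproj P t y hP ltac:(lra))) as [hk he].
set (z := Vinv U P s t (Qproj P t y)) in *.
assert (QU : forall tau, s <= tau -> Qproj P tau (U tau s z) = U tau s z).
{ intros tau htau. apply Qproj_of_Ker, Ker_orbit; [split; lra | exact hk]. }
assert (hv : 0 <= norm z) by apply norm_ge_0.
assert (hw := exp_pos (eps * s + omega)).
assert (hMw : 0 < M * exp (eps * s + omega)) by (apply Rmult_lt_0_compat; lra).
assert (energy : (exp (- gamma * (s + 1)) * (norm z / (M * exp (eps * s + omega)))) ^ 2
   <= RInt (fun tau => norm (weighted (- gamma) (complement P) tau (U tau s z)) ^ 2) s t).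
{ apply orbit_energy_ge with (- gamma) s; try lra.
  - apply Rmult_le_pos; [apply Rlt_le, exp_pos|]. now apply Rdiv_le_0_compat.
  - intros tau htau. simpl. rewrite QU, norm_scal_real by (lra || apply exp_pos).
    reflexivity.
  - intros tau htau.
    apply Rmult_le_compat; [apply Rlt_le, exp_pos | now apply Rdiv_le_0_compat | |].
    + apply exp_le. nra.
    + (* Growth of the inverse flow from [tau] down to [s], with [tau <= s + 1]. *)
      apply Rle_div_l; [exact hMw|].
      rewrite <- (Vinv_unique tau s z) at 1 by (exact hk || (split; lra)).
      rewrite <- (QU tau) at 1 by lra.
      eapply Rle_trans; [apply growth_unstable; split; lra|].
      rewrite (Rmult_comm (norm _)). apply Rmult_le_compat_r; [apply norm_ge_0|].
      rewrite Rmult_assoc, <- exp_plus. apply Rmult_le_compat_l; [lra|].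
      apply exp_le. nra. }
assert (h1 := hdec t s z hd). rewrite he in h1.
destruct (hbd s z hs) as [[_ hneg] _].
rewrite (Qproj_of_Ker P s z hk) in hneg.
destruct (hbd t y) as [[hPpos _] hsum]; [lra|].
assert (h2 : - L t (Qproj P t y) <= exp (- gamma * t + delta * t) ^ 2 * (K * norm y ^ 2)).
{ assert (hg := exp_pos (- 2 * gamma * t)).
  assert (hLt : exp (2 * gamma * t) * - L t (Qproj P t y)
                  <= K * exp (2 * delta * t) * norm y ^ 2) by nra.
  apply (Rmult_le_compat_l (exp (- 2 * gamma * t))) in hLt; [|lra].
  rewrite <- Rmult_assoc, <- exp_plus in hLt.
  replace (- 2 * gamma * t + 2 * gamma * t) with 0 in hLt by ring.
  rewrite exp_0, Rmult_1_l in hLt. apply Rle_trans with (1 := hLt). right.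
  replace (exp (- gamma * t + delta * t) ^ 2)
    with (exp (- 2 * gamma * t) * exp (2 * delta * t)); [ring|].
  simpl. rewrite Rmult_1_r, <- !exp_plus. f_equal. ring. }
assert (h3 : norm z <= K * M * exp (eps * s + omega - - gamma * (s + 1)
                                     + (- gamma * t + delta * t)) * norm y).
{ apply value_le_of_energy_le; [exact hv | apply norm_ge_0 | lra]. }
apply Rle_trans with (1 := h3). right.
rewrite !(Rmult_assoc (K * M)), <- !Rmult_assoc, !(Rmult_assoc (K * M)), <- !exp_plus.
do 3 f_equal. ring.
Qed.

(** Over less than one unit of time growth is decay: the loss is at most
    [e^(omega + gamma)]. *)
Lemma decay_of_growth (v n t s beta : R) :
  s <= t < s + 1 -> 0 <= s -> 0 <= n -> 0 < beta <= gamma ->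
  v <= M * exp (eps * s) * exp (omega * (t - s)) * n ->
  v <= K * M * exp (omega + gamma) * exp ((eps + delta) * s) * exp (- beta * (t - s)) * n.
Proof.
intros hts hs hn hb h. destruct hgrowth as [hM [heps [homega _]]].
apply Rle_trans with (1 := h). apply Rmult_le_compat_r; [exact hn|].
rewrite (Rmult_assoc M), (Rmult_assoc (K * M * _)), (Rmult_assoc (K * M)), <- !exp_plus.
apply Rmult_le_compat; [lra | apply Rlt_le, exp_pos | nra |].
apply exp_le.
assert (0 <= delta * s) by nra.
assert (omega * (t - s) <= omega) by nra.
assert (beta * (t - s) <= gamma) by nra.
nra.
Qed.

Lemma dichotomy_of_lyapunov : strong_exponential_dichotomy U.
Proof.
destruct hgrowth as [hM [heps [homega _]]].
set (beta := Rmin (gamma - eps) (gamma - delta)).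
assert (hb : 0 < beta <= gamma - eps /\ beta <= gamma - delta).
{ split; [split|]; [apply Rmin_glb_lt; lra | apply Rmin_l | apply Rmin_r]. }
(* Both parts decay at the slower of their two rates. *)
assert (slower : forall b t s A n, beta <= b -> s <= t -> 0 <= A -> 0 <= n ->
   A * exp (- b * (t - s)) * n <= A * exp (- beta * (t - s)) * n).
{ intros b t s A n hbb hts hA hn. apply Rmult_le_compat_r; [exact hn|].
  apply Rmult_le_compat_l; [exact hA|]. apply exp_le. nra. }
set (N := K * M * exp (omega + gamma)).
assert (hKM : 1 <= K * M) by nra.
assert (hN : 1 <= N).
{ assert (1 <= exp (omega + gamma)) by (rewrite <- exp_0; apply exp_le; lra).
  unfold N. nra. }
assert (hA : forall s, 0 <= N * exp ((eps + delta) * s)).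
{ intros s. apply Rmult_le_pos; [lra | apply Rlt_le, exp_pos]. }
exists P. split; [exact hP|]. split; [exact hUP|].
exists N, (eps + delta), beta.
split; [exact hN|]. split; [lra|]. split; [lra|].
intros t s hd. assert (hd' := hd). destruct hd' as [hs hst].
split; (apply op_norm_le;
  [apply Rmult_le_pos; [apply hA | apply Rlt_le, exp_pos]|]); intros x;
  assert (hx := @norm_ge_0 F X x);
  destruct (Rlt_le_dec t (s + 1)) as [hlt | hle].
- apply decay_of_growth; try lra. now apply growth_stable.
- eapply Rle_trans; [now apply stable_decay|]. apply slower; auto; lra.
- apply decay_of_growth; try lra. now apply growth_unstable.
- eapply Rle_trans; [now apply unstable_decay|]. apply slower; auto; lra.
Qed.

End Dichotomy.

Theorem theorem3p10 :
  forall (F : AbsRing) (hF : F = R_AbsRing \/ F = C_AbsRing)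
    (X : CompleteNormedModule F)
    (U : R -> R -> bounded_op X) (P : R -> bounded_op X)
    (hU : evolution_operator U) (hP : projection_valued P) (hUP : compatible U P)
    (M eps omega : R) (hgrowth : P_exponential_growth U P M eps omega)
    (K gamma delta : R) (hK : 1 <= K) (hgamma : eps < gamma)
    (hdelta : 0 <= delta < gamma)
    (hL : forall H : R -> bounded_op X, in_H gamma P H ->
       exists L : R -> X -> R,
         lyapunov_function U H L /\
         (forall t x, 0 <= t ->
            (0 <= L t (P t x) /\ L t (Qproj P t x) <= 0) /\
            exp (- 2 * gamma * t) * L t (P t x)
              - exp (2 * gamma * t) * L t (Qproj P t x)
              <= K * exp (2 * delta * t) * norm x ^ 2)),
    strong_exponential_dichotomy U.
Proof.
intros F hF X U P hU hP hUP M eps omega hgrowth K gamma delta hK hgamma hdelta hL.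
assert (hi : exists iota : R -> F, real_scalars iota).
{ destruct hF as [-> | ->]; eexists; [exact real_scalars_R | exact real_scalars_C]. }
destruct hi as [iota hi].
exact (dichotomy_of_lyapunov iota hi U P hU hP hUP M eps omega hgrowth
         K gamma delta hK hgamma hdelta hL).
Qed.
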